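(* Let $X$ be a sober $T_1$ topological space. If the open set lattice $\mathcal{O}(X)$ of $X$ is countable, then $X$, and hence $\mathcal{O}(X)$, must be finite.
   Context: A space $X$ is sober if every irreducible closed subset is the closure of a unique singleton. $\mathcal{O}(X)$ is the lattice of open subsets of $X$. *)

(* Defs.v *)
From HB Require Import structures.
From mathcomp Require Import all_boot all_order.
From mathcomp Require Import all_classical topology.

Set Implicit Arguments.
Unset Strict Implicit.
Unset Printing Implicit Defensive.

Local Open Scope classical_set_scope.

(* The empty set is not irreducible: otherwise no space would be sober. *)
Definition irreducible_set (X : topologicalType) (C : set X) : Prop :=
  C !=set0 /\
  forall F G : set X, closed F -> closed G ->
    C `<=` F `|` G -> C `<=` F \/ C `<=` G.

Definition sober_space (X : topologicalType) : Prop :=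
  forall C : set X, closed C -> irreducible_set C ->
    exists! x : X, C = closure [set x].

Definition open_lattice (X : topologicalType) : set (set X) :=
  [set U : set X | open U].
Arguments open_lattice : clear implicits.

(* Main.v *)
Require Import Defs.
From mathcomp Require Import all_boot all_order.
From mathcomp Require Import finmap.
From mathcomp Require Import all_classical topology.

(** Suppose that X is infinite.  The key point is that an infinite open set
    W always contains a nonempty open set and, disjoint from it, another
    infinite open set.  Indeed W is not irreducible: if it were, so would be its
    closure, which by soberness and T1 would be a single point.  So W contains
    two disjoint nonempty open sets A and B.  If one of them is infinite, the
    pair is as wanted; if A is finite, then it is closed and W minus A is
    open and infinite.

    Splitting X over and over in this way (splitting_disjoint_sequence)
    produces an infinite sequence of pairwise disjoint nonempty open sets.
    Distinct subsets of the natural numbers index distinct unions of members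
    of that sequence, so X has at least continuum many open sets
    (disjoint_opens_uncountable), and the topology is uncountable.  Hence X is
    finite, and so is its power set, which contains the topology. *)

Local Open Scope classical_set_scope.

Lemma finite_subsets {T : choiceType} (A : set T) :
  finite_set A -> finite_set [set B : set T | B `<=` A].
Proof.
move=> /finite_fsetP[F ->].
have finP := finite_image (fun G : {fset T} => [set` G])
  (finite_fset (fpowerset F)).
apply: sub_finite_set finP => B BF.
have Bfin : finite_set B by exact: sub_finite_set BF (finite_fset F).
exists (fset_set B); last exact: fset_setK.
rewrite /= fpowersetE; apply/fsubsetP => x.
by rewrite in_fset_set // inE => /BF.
Qed.

(** Cantor's diagonal argument: the values of an injective g at the sets that
    do not contain them would form a set that neither contains nor omits its
    own value. *)
Lemma powerset_nat_not_inj (g : set nat -> nat) : ~ injective g.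
Proof.
move=> ginj.
pose D := [set n | exists2 A, g A = n & ~ A n].
have ND : ~ D (g D) by move=> /[dup] DgD [A /ginj ->].
by apply: (ND); exists D.
Qed.

Lemma bigcup_trivIset_inj {T : Type} (V : nat -> set T) :
  trivIset [set: nat] V -> (forall n, V n !=set0) ->
  injective (fun A : set nat => \bigcup_(n in A) V n).
Proof.
move=> Vdisj Vn0.
have sub A B : \bigcup_(n in A) V n = \bigcup_(n in B) V n -> A `<=` B.
  move=> eqAB n An; have [x Vnx] := Vn0 n.
  have [m Bm Vmx] : (\bigcup_(n in B) V n) x by rewrite -eqAB; exists n.
  by rewrite (Vdisj n m) //; exists x.
by move=> A B eqAB; rewrite eqEsubset; split; apply: sub.
Qed.

Lemma disjoint_opens_uncountable {X : topologicalType} (V : nat -> set X) :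
  (forall n, open (V n)) -> (forall n, V n !=set0) ->
  trivIset [set: nat] V -> ~ countable (open_lattice X).
Proof.
move=> Vop Vn0 Vdisj /countable_injP[f finj].
apply: (powerset_nat_not_inj (fun A => f (\bigcup_(n in A) V n))) => A B eqf.
apply: (bigcup_trivIset_inj V Vdisj Vn0).
by apply: finj eqf; rewrite inE; apply: bigcup_open => n _; exact: Vop.
Qed.

(** A property of sets that splits off a piece can be applied forever: the
    remainders decrease, and each piece is disjoint from the remainder that
    contains all the later pieces. *)
Lemma splitting_disjoint_sequence {T : Type} (P Q : set T -> Prop) :
  (forall W, P W -> exists V W',
    [/\ Q V, P W', V `<=` W, W' `<=` W & V `&` W' = set0]) ->
  forall W, P W -> exists V : nat -> set T,
    (forall n, Q (V n)) /\ trivIset [set: nat] V.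
Proof.
move=> split W PW.
(* A state of the iteration is a remainder satisfying P together with the
   piece last split off; the initial piece is a dummy, hence the shift below. *)
pose step (s t : {W | P W} * set T) :=
  [/\ Q t.2, t.2 `<=` sval s.1, sval t.1 `<=` sval s.1
    & t.2 `&` sval t.1 = set0].
have next s : {t | step s t}.
  apply: cid; case: s => [[U PU] ?].
  have [V [U' [QV PU' VU UU' VU'0]]] := split U PU.
  by exists (exist _ U' PU', V).
have [u [_ ustep]] := dependent_choice next (exist _ W PW, set0).
exists (fun n => (u n.+1).2); split=> [n|]; first by have [] := ustep n.
have rem_sub n k : sval (u (n + k)).1 `<=` sval (u n).1.
  elim: k => [|k IH]; first by rewrite addn0.
  by rewrite addnS => x; have [_ _ sub _] := ustep (n + k) => /sub/IH.
have lt_disj m n : (m < n)%N -> (u m.+1).2 `&` (u n.+1).2 = set0.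
  move=> mn; have [_ _ _ dis] := ustep m.
  rewrite -subset0 => x [um un]; rewrite -dis; split=> //.
  have [_ sub _ _] := ustep n.
  by apply: (rem_sub m.+1 (n - m.+1)); rewrite subnKC //; exact: sub.
apply/trivIsetP => m n _ _; rewrite neq_ltn => /orP[] /lt_disj // nm.
by rewrite setIC.
Qed.

(** This is where soberness enters: a nonempty open set without two disjoint
    nonempty open subsets has an irreducible closure, which in a sober T1 space is a
    single point. *)
Lemma sober_T1_two_disjoint_opens {X : topologicalType} (W : set X) :
  sober_space X -> accessible_space X -> open W -> infinite_set W ->
  exists A B : set X, [/\ open A, open B, A !=set0 & B !=set0] /\
    [/\ A `<=` W, B `<=` W & A `&` B = set0].
Proof.
move=> Xsober XT1 Wop Winf.
have /not_andP[clW0|/existsNP[F /existsNP[G]]] : ~ irreducible_set (closure W).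
- move=> /(Xsober _ (@closed_closure _ _))[x [clWx _]].
  apply: Winf; apply: (@sub_finite_set _ _ [set x]); last exact: finite_set1.
  have /closure_id -> : closed [set x] by exact: accessible_closed_set1.
  by rewrite -clWx; exact: subset_closure.
- case: clW0; have /infinite_setN0[x Wx] := Winf.
  by exists x; exact: subset_closure.
- move=> /not_implyP[Fcl] /not_implyP[Gcl] /not_implyP[WFG] /not_orP[nWF nWG].
  have diff_open H : closed H -> open (W `\` H).
    by move=> Hcl; rewrite setDE; apply: openI => //; rewrite openC.
  have diff_n0 H : closed H -> ~ closure W `<=` H -> W `\` H !=set0.
    move=> Hcl; apply: contra_notP => /set0P/negP/negPn/eqP WH0.
    by rewrite (closure_id H).1 //; apply: closureS; rewrite -setD_eq0.
  exists (W `\` F), (W `\` G); split; split; try exact: subDsetl.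
  + exact: diff_open.
  + exact: diff_open.
  + exact: diff_n0.
  + exact: diff_n0.
  + rewrite -subset0 => x [[Wx nFx] [_ nGx]].
    by have [] := WFG x (subset_closure Wx).
Qed.

Lemma sober_T1_split_infinite_open {X : topologicalType} (W : set X) :
  sober_space X -> accessible_space X -> open W -> infinite_set W ->
  exists V W' : set X, [/\ open V /\ V !=set0, open W' /\ infinite_set W',
    V `<=` W, W' `<=` W & V `&` W' = set0].
Proof.
move=> Xsober XT1 Wop Winf.
have [A [B [[Aop Bop A0 B0] [AW BW AB]]]] :=
  sober_T1_two_disjoint_opens W Xsober XT1 Wop Winf.
have [Afin|Ainf] := pselect (finite_set A).
(* T1 makes a finite set A closed, so that W minus A is open. *)
- exists A, (W `\` A); split=> //; [split|].
  + rewrite setDE; apply: openI => //; rewrite openC.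
    exact: accessible_finite_set_closed.1.
  + exact: infinite_setD.
  + by rewrite setDIK.
- by exists B, A; rewrite setIC.
Qed.

Theorem corollary3p3 (X : topologicalType)
  (Xsober : sober_space X) (XT1 : accessible_space X)
  (OXcountable : countable (open_lattice X)) :
  finite_set [set: X] /\ finite_set (open_lattice X).
Proof.
have Xfin : finite_set [set: X].
  apply: contrapT => Xinf.
  have [V [VQ Vdisj]] := splitting_disjoint_sequence
    (fun W : set X => open W /\ infinite_set W)
    (fun V : set X => open V /\ V !=set0)
    (fun W PW => sober_T1_split_infinite_open W Xsober XT1 PW.1 PW.2)
    setT (conj openT Xinf).
  by apply: (disjoint_opens_uncountable V) OXcountable => // n; case: (VQ n).
split=> //.
by apply: sub_finite_set (finite_subsets _ Xfin) => U _.
Qed.
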